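(* Every ordered set is a generalized ordered set.
   Context: The setting is constructive mathematics: no use of the law of excluded middle. An ordered set is a set $X$ with a binary relation $<$ such that for all $x,y,z\in X$: (1) $x<y$ implies $\neg(y<x)$; (2) $x<y$ implies $x<z$ or $z<y$ (cotransitivity); (3) $\neg(x<y)$ and $\neg(y<x)$ imply $x=y$ (negative antisymmetry). For a set $X$ with a binary relation $<$, write $x\leq_{P}y$ if for all $z\in X$, $z<x$ implies $z<y$, and $y<z$ implies $x<z$. A generalized ordered set is a set $X$ with a binary relation $<$ such that for all $x,y,z\in X$: (asymmetry) $x<y$ implies $\neg(y<x)$; (transitivity) $x<y$ and $y<z$ imply $x<z$; (positive antisymmetry) $x\leq_{P}y$ and $y\leq_{P}x$ imply $x=y$. *)

(* Defs.v *)
(* Plain Rocq logic, no axioms: the setting is constructive. *)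

Record ordered_set (X : Type) (lt : X -> X -> Prop) : Prop := {
  os_asymmetry : forall x y : X, lt x y -> ~ lt y x;
  os_cotransitivity : forall x y z : X, lt x y -> lt x z \/ lt z y;
  os_negative_antisymmetry : forall x y : X, ~ lt x y -> ~ lt y x -> x = y
}.

Definition leP (X : Type) (lt : X -> X -> Prop) (x y : X) : Prop :=
  forall z : X, (lt z x -> lt z y) /\ (lt y z -> lt x z).

Record generalized_ordered_set (X : Type) (lt : X -> X -> Prop) : Prop := {
  gos_asymmetry : forall x y : X, lt x y -> ~ lt y x;
  gos_transitivity : forall x y z : X, lt x y -> lt y z -> lt x z;
  gos_positive_antisymmetry :
    forall x y : X, leP X lt x y -> leP X lt y x -> x = y
}.

(* Main.v *)
Require Import Defs.

(** Transitivity is cotransitivity with asymmetry: comparing z with x < y gives x < z or z < y, and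
    y < z excludes the latter. Positive antisymmetry reduces to the negative one, since y ≤_P x
    refutes x < y and x ≤_P y refutes y < x. *)

Theorem theorem7 (X : Type) (lt : X -> X -> Prop) :
  ordered_set X lt -> generalized_ordered_set X lt.
Proof.
  intros [asym cotrans nanti].
  split.
  - exact asym.
  - intros x y z Hxy Hyz.
    destruct (cotrans x y z Hxy) as [Hxz | Hzy].
    + exact Hxz.
    + destruct (asym y z Hyz Hzy).
  - intros x y Hle Hge.
    apply nanti; intros Hlt.
    (* Testing [leP] at the smaller of the two points yields a point below itself, against
       asymmetry. *)
    + pose proof (proj1 (Hge x) Hlt) as Hxx.
      exact (asym x x Hxx Hxx).
    + pose proof (proj1 (Hle y) Hlt) as Hyy.
      exact (asym y y Hyy Hyy).
Qed.
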